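(* Let $(f_n)_{n\in\mathbb{N}}\in\ell^1\setminus c_{00}$ and let $\Omega=\{(x_n)\in c_0:\ \sum_{n} f_nx_n>0\}$, considered with its quasihyperbolic metric. Then for any pair of distinct points $x,y\in\Omega$ there is no quasihyperbolic geodesic joining $x$ and $y$ in $\Omega$.
   Context: All spaces are over the real field. $c_0$ is the Banach space of real sequences converging to $0$ with the sup-norm, $\ell^1$ is the space of absolutely summable real sequences, and $c_{00}$ is the space of real sequences with only finitely many nonzero terms. For an open path-connected proper subset $\Omega$ of a Banach space, the quasihyperbolic length of a rectifiable path $\gamma$ in $\Omega$ is $\ell_{\mathrm{qh}}(\gamma)=\int_\gamma \frac{ds}{\mathrm{dist}(\cdot,\partial\Omega)}$, where the integral is with respect to norm arc length and $\mathrm{dist}$ is the norm distance. The quasihyperbolic metric is $k_\Omega(x,y)=\inf_\gamma \ell_{\mathrm{qh}}(\gamma)$, the infimum over rectifiable paths in $\Omega$ joining $x$ and $y$. A quasihyperbolic geodesic joining $x$ and $y$ is a rectifiable path in $\Omega$ from $x$ to $y$ attaining this infimum. *)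

(* Defs.v *)
From HB Require Import structures.
From mathcomp Require Import all_boot all_order all_algebra.
From mathcomp Require Import all_classical all_reals all_analysis.
From mathcomp Require Import lra.

Set Implicit Arguments.
Unset Strict Implicit.
Unset Printing Implicit Defensive.

Import Order.TTheory GRing.Theory Num.Theory.
Import numFieldNormedType.Exports.

Local Open Scope classical_set_scope.
Local Open Scope ring_scope.

Section c0_space.
Context {R : realType}.

Definition c0_pred : {pred (nat -> R)} := mem [set u : nat -> R | u @ \oo --> 0].

Lemma c0_submod_closed : submod_closed c0_pred.
Proof.
split=> [|a u v]; first by rewrite inE; exact: cvg_cst.
rewrite !inE/= => u0 v0.
rewrite -[0]addr0 -[in X in _ --> X + _](scaler0 _ a).
by apply: cvgD => //; exact: cvgZl_tmp.
Qed.

HB.instance Definition _ := GRing.isSubmodClosed.Build R (nat -> R) c0_pred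
  c0_submod_closed.

End c0_space.

Record c0 (R : realType) := C0 {
  c0_val :> nat -> R ;
  c0_valP : c0_val \in c0_pred }.

Section c0_normed.
Context {R : realType}.

HB.instance Definition _ := [isSub for @c0_val R].
HB.instance Definition _ := [Choice of c0 R by <:].
HB.instance Definition _ := [SubChoice_isSubLmodule of c0 R by <:].

Implicit Types x y : c0 R.

Lemma c0_cvg x : x n @[n --> \oo] --> (0 : R).
Proof. by have := c0_valP x; rewrite inE. Qed.

Definition c0_norm x : R := sup (range (fun n => `|x n|)).

Lemma c0_has_sup x : has_sup (range (fun n => `|x n|)).
Proof.
split; first by exists `|x 0%N|, 0%N.
have /cvg_seq_bounded[M [_ /(_ (M + 1))]] : cvgn (x : nat -> R).
  by apply/cvg_ex; exists 0; exact: c0_cvg.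
rewrite ltrDl ltr01 => /(_ isT) xM.
by exists (M + 1) => _ [n _ <-]; exact: xM.
Qed.

Lemma c0_norm_ub x n : `|x n| <= c0_norm x.
Proof. by apply: sup_upper_bound; [exact: c0_has_sup|exists n]. Qed.

Lemma c0_norm_le x (M : R) : (forall n, `|x n| <= M) -> c0_norm x <= M.
Proof.
move=> xM; apply: ge_sup; first by exists `|x 0%N|, 0%N.
by move=> _ [n _ <-].
Qed.

Lemma c0_normD x y : c0_norm (x + y) <= c0_norm x + c0_norm y.
Proof.
apply: c0_norm_le => n.
by rewrite (le_trans (ler_normD _ _))// lerD// c0_norm_ub.
Qed.

Lemma c0_normZ (a : R) x : c0_norm (a *: x) = `|a| * c0_norm x.
Proof.
have H b y : c0_norm (b *: y) <= `|b| * c0_norm y.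
  apply: c0_norm_le => n.
  by rewrite [X in `|X|](_ : _ = b * y n)// normrM ler_wpM2l// c0_norm_ub.
apply/le_anti; rewrite H/=.
have [->|a0] := eqVneq a 0.
  rewrite normr0 mul0r; apply: le_trans (c0_norm_ub _ 0%N); exact: normr_ge0.
rewrite -ler_pdivlMl ?normr_gt0// -normfV.
by rewrite -{1}[x](scalerK a0) H.
Qed.

Lemma c0_norm0_eq0 x : c0_norm x = 0 -> x = 0.
Proof.
move=> x0; apply/val_inj/funext => n /=; apply/normr0_eq0/le_anti.
by rewrite normr_ge0 -x0 c0_norm_ub.
Qed.

HB.instance Definition _ := @Lmodule_isNormed.Build R (c0 R) c0_norm
  c0_normD c0_normZ c0_norm0_eq0.

Lemma c0_normE x : `|x| = c0_norm x. Proof. by []. Qed.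

Lemma c0_complete (F : set_system (c0 R)) :
  ProperFilter F -> cauchy F -> cvg F.
Proof.
move=> FF /cauchyP F_cauchy.
have coord x y n : `|x n - y n| <= `|x - y| by exact: c0_norm_ub (x - y) n.
have F_coord n : cvg ((fun x : c0 R => x n) @ F).
  apply/cauchy_cvgP/cauchy_exP => e e0.
  have [x0 Fx0] := F_cauchy _ e0.
  have S : ball x0 e `<=` (fun x : c0 R => x n) @^-1` ball (x0 n) e.
    by move=> x; rewrite /= -!ball_normE/=; exact: le_lt_trans.
  by exists (x0 n); exact: filterS S Fx0.
pose l n : R := lim ((fun x : c0 R => x n) @ F).
have F_unif (e : R) : 0 < e ->
    exists2 x0 : c0 R, F (ball x0 e) & forall n, `|l n - x0 n| <= e + e.
  move=> e0; have [x0 Fx0] := F_cauchy _ e0; exists x0 => // n.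
  have /cvgrPdist_lt/(_ _ e0) Fn := F_coord n.
  have [x [/= lx]] := filter_ex (filterI Fn Fx0).
  rewrite -ball_normE/= => x0x.
  rewrite -(subrKA (x n)) (le_trans (ler_normD _ _))// lerD// ltW//.
  by rewrite distrC (le_lt_trans (coord _ _ _)).
have l0 : l \in @c0_pred R.
  rewrite inE/=; apply/cvgrPdist_le => e e0.
  have e3 : 0 < e / 3 by rewrite divr_gt0.
  have [x0 _ lx0] := F_unif _ e3.
  have /cvgrPdist_le/(_ _ e3) := @c0_cvg x0.
  apply: filterS => n; rewrite !sub0r !normrN => x0n.
  rewrite -(subrK (x0 n) (l n)) (le_trans (ler_normD _ _))//.
  have := lerD (lx0 n) x0n; move/le_trans; apply; lra.
apply/cvg_ex; exists (C0 l0); apply/cvgrPdist_le => e e0.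
have e3 : 0 < e / 3 by rewrite divr_gt0.
have [x0 Fx0 lx0] := F_unif _ e3.
apply: filterS Fx0 => x; rewrite -ball_normE/= => x0x.
apply: c0_norm_le => n; rewrite [X in `|X|](_ : _ = l n - x n)//.
rewrite -(subrKA (x0 n)) (le_trans (ler_normD _ _))//.
have := lerD (lx0 n) (le_trans (coord x0 x n) (ltW x0x)).
by move/le_trans; apply; lra.
Qed.

HB.instance Definition _ := Uniform_isComplete.Build (c0 R) c0_complete.

End c0_normed.

Section quasihyperbolic.
Context {R : realType} {V : completeNormedModType R}.
Implicit Types (A Omega : set V) (gamma : R -> V) (a b : R) (x y : V).

Definition boundary A : set V := closure A `\` A°.

(* [variation] and [total_variation] of the library are restricted to
   real-valued functions. *)
Definition path_variation a b gamma (s : seq R) : R :=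
  let F := gamma \o nth b (a :: s) in
  \sum_(0 <= n < size s) `|F n.+1 - F n|.

Definition path_length a b gamma : \bar R :=
  ereal_sup [set (path_variation a b gamma s)%:E | s in itv_partition a b].

Definition arclength a gamma (t : R) : R := fine (path_length a t gamma).

(* The arc length parametrization of a rectifiable path [gamma] on [a, b]: the
   value at [u] does not depend on the chosen [t], since [gamma] is constant
   where its arc length is. *)
Definition arc_param a b gamma (u : R) : V :=
  gamma (xget a [set t | t \in `[a, b] /\ arclength a gamma t = u]).

Definition path_integral a b gamma (rho : V -> \bar R) : \bar R :=
  \int[lebesgue_measure]_(u in `[0, arclength a gamma b])
    rho (arc_param a b gamma u).

Record rectifiable_path Omega x y a b gamma : Prop := RectifiablePath {
  path_le : a <= b ;
  path_continuous : {within `[a, b], continuous gamma} ;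
  path_in : forall t, t \in `[a, b] -> Omega (gamma t) ;
  path_start : gamma a = x ;
  path_end : gamma b = y ;
  path_rectifiable : (path_length a b gamma < +oo)%E }.

(* On an open [Omega] with nonempty boundary the distance to the boundary is
   finite and positive, so that this extended-real inverse is a real one. *)
Definition qh_length Omega a b gamma : \bar R :=
  path_integral a b gamma (fun z => (edist_inf (boundary Omega) z)^-1)%E.

Definition qh_metric Omega x y : \bar R :=
  ereal_inf [set l | exists a b gamma,
    rectifiable_path Omega x y a b gamma /\ l = qh_length Omega a b gamma].

Definition qh_geodesic Omega x y a b gamma : Prop :=
  rectifiable_path Omega x y a b gamma /\
  qh_length Omega a b gamma = qh_metric Omega x y.

End quasihyperbolic.

Section half_space.
Context {R : realType}.
Implicit Types f : nat -> R.

Definition l1 : set (nat -> R) := [set f : nat -> R | cvgn [normed series f]].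

Definition c00 : set (nat -> R) := [set f : nat -> R | finite_set [set n | f n != 0]].

Definition half_space f : set (c0 R) :=
  [set x | 0 < limn (series (fun n => f n * x n))].

End half_space.

(* Main.v *)
Require Import Defs.
From mathcomp Require Import all_boot all_order all_algebra.
From mathcomp Require Import all_classical all_reals all_analysis.
From mathcomp Require Import lra.

Set Implicit Arguments.
Unset Strict Implicit.
Unset Printing Implicit Defensive.

Import Order.TTheory GRing.Theory Num.Theory.
Import numFieldNormedType.Exports.

Local Open Scope classical_set_scope.
Local Open Scope ring_scope.

(** Write F for the functional x |-> sum_n f_n x_n. Since F is bounded with norm
    equal to the l1-norm of f, the distance from a point z of the half space to
    the boundary is F z / ||f||_1 ([edist_boundary_half_space]). The
    quasihyperbolic length of a path whose arc length parametrization is sigma,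
    defined on [0, L], is therefore the integral over [0, L] of
    ||f||_1 / F (sigma t): among the paths of a given length, the higher ones
    are the shorter ones.

    The sup-norm only asks each coordinate to move at speed at most 1. In a path
    of length L > 0 from x to y one may hence replace the n-th coordinate by
    the extreme one: with e the sign of f_n, let e times that coordinate go up
    at unit speed from e x_n, and then down at unit speed to e y_n
    ([roof], [raised_path]). This never lowers F
    ([functional_raised_path_le]). The new path is 1-Lipschitz, and it has unit
    speed because its n-th coordinate has; so it is parametrized by its own arc
    length and has the same length L ([raised_path_arclength]).

    The new path is strictly better for a suitable n: at time L / 2 the new
    n-th coordinate has absolute value close to L / 2 when n is large, because
    x_n and y_n tend to 0, whereas the old one, being the n-th coordinate of a
    fixed element of c0, tends to 0. As f has infinitely many nonzero terms,
    one can choose such an n with f_n nonzero, and then F is strictly larger at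
    L / 2 ([functional_raised_path_lt]). By continuity the quasihyperbolic length
    strictly decreases ([integral_itv_lt]), so that no path is a geodesic.

    The statement about a given path requires its arc length parametrization to
    be a genuine 1-Lipschitz path; this rests on the arc length of a continuous
    rectifiable path taking all intermediate values ([arclength_surj]). *)

(** * Length of paths in a normed space *)

Section path_length.
Context {R : realType} {V : completeNormedModType R}.
Implicit Types (gamma : R -> V) (a b c t u : R) (s : seq R).

(** The length of the polygonal line with vertices the images by [gamma] of
    [a] and of the elements of [s]. *)
Fixpoint polygonal_length gamma a s : R :=
  if s is x :: s' then `|gamma x - gamma a| + polygonal_length gamma x s'
  else 0.

Lemma path_variationE gamma a b s :
  path_variation a b gamma s = polygonal_length gamma a s.
Proof.
rewrite /path_variation; elim: s a => [|x s IHs] a /=; first by rewrite big_nil.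
by rewrite big_nat_recl//= -IHs.
Qed.

Lemma polygonal_length_cat gamma a s1 s2 :
  polygonal_length gamma a (s1 ++ s2) =
  polygonal_length gamma a s1 + polygonal_length gamma (last a s1) s2.
Proof. by elim: s1 a => [|x s IHs] a /=; rewrite ?add0r// IHs addrA. Qed.

Lemma polygonal_length_rcons gamma a s x :
  polygonal_length gamma a (rcons s x) =
  polygonal_length gamma a s + `|gamma x - gamma (last a s)|.
Proof. by rewrite -cats1 polygonal_length_cat/= addr0. Qed.

(** Inserting the point [c] in a partition does not decrease the length of the
    inscribed polygonal line. *)
Lemma polygonal_length_split gamma a b c s : itv_partition a b s ->
  a <= c -> c <= b -> exists s1 s2,
  [/\ itv_partition a c s1, itv_partition c b s2 &
    polygonal_length gamma a s <=
    polygonal_length gamma a s1 + polygonal_length gamma c s2].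
Proof.
elim: s a => [|x s IHs] a /=.
  move=> /itv_partition_nil <- ac ca.
  have -> : c = a by apply/le_anti/andP.
  by exists [::], [::]; split; rewrite /itv_partition//= addr0.
move=> /[dup] /itv_partition_cons xs [/= /andP[ax xsp] lxs].
rewrite le_eqVlt => /orP[/eqP <-|ac] cb.
  by exists [::], (x :: s); split; rewrite /itv_partition//= ?add0r// ax.
have [xc|cx] := leP x c.
  have [s1 [s2 [p1 p2 le12]]] := IHs _ xs xc cb.
  exists (x :: s1), s2; split=> //.
    by move: p1 => [p1 l1]; split => //=; rewrite ax.
  by rewrite /= -addrA lerD2l.
exists [:: c], (x :: s); split.
- by rewrite /itv_partition /= ac.
- by split => //=; rewrite cx.
- by rewrite /= addr0 addrA lerD2r addrC (le_trans _ (ler_normD _ _))// subrKA.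
Qed.

Lemma polygonal_le_path_length gamma a b s : itv_partition a b s ->
  ((polygonal_length gamma a s)%:E <= path_length a b gamma)%E.
Proof.
by move=> p; apply: ereal_sup_ubound; exists s => //; rewrite path_variationE.
Qed.

Lemma path_length_le gamma a b (M : \bar R) :
  (forall s, itv_partition a b s -> ((polygonal_length gamma a s)%:E <= M)%E) ->
  (path_length a b gamma <= M)%E.
Proof.
by move=> H; apply: ge_ereal_sup => _ [s p <-]; rewrite path_variationE; exact: H.
Qed.

Lemma dist_le_path_length gamma a b : a <= b ->
  (`|gamma b - gamma a|%:E <= path_length a b gamma)%E.
Proof.
rewrite le_eqVlt => /orP[/eqP <-|ab].
  rewrite subrr normr0.
  by apply: (@polygonal_le_path_length gamma a a [::]).
by have := polygonal_le_path_length gamma (itv_partition1 ab); rewrite /= addr0.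
Qed.

Lemma path_length_ge0 gamma a b : a <= b -> (0 <= path_length a b gamma)%E.
Proof.
by move=> ab; apply: le_trans (dist_le_path_length gamma ab); rewrite lee_fin.
Qed.

Lemma path_lengthxx gamma a : path_length a a gamma = 0%E.
Proof.
apply/le_anti; rewrite path_length_ge0// andbT; apply: path_length_le => s.
by move=> /itv_partitionxx ->.
Qed.

Lemma path_lengthD gamma a b c : a <= c -> c <= b ->
  (path_length a b gamma = path_length a c gamma + path_length c b gamma)%E.
Proof.
move=> ac cb; apply/le_anti/andP; split.
  apply: path_length_le => s p.
  have [s1 [s2 [p1 p2]]] := polygonal_length_split gamma p ac cb.
  rewrite -lee_fin EFinD => /le_trans; apply.
  by apply: leeD; exact: polygonal_le_path_length.
have [->|/eqP abfin] := eqVneq (path_length a b gamma) +oo%E; first exact: leey.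
have cat s1 s2 : itv_partition a c s1 -> itv_partition c b s2 ->
   ((polygonal_length gamma a s1)%:E + (polygonal_length gamma c s2)%:E
     <= path_length a b gamma)%E.
  move=> p1 p2.
  have [_ /eqP lc] := p1.
  rewrite -EFinD -{1}lc -polygonal_length_cat.
  exact/polygonal_le_path_length/(itv_partition_cat p1 p2).
have abf : (path_length a b gamma) \is a fin_num.
  by rewrite ge0_fin_numE ?ltey; [exact/eqP|exact/path_length_ge0/(le_trans ac)].
have {}cat s1 : itv_partition a c s1 ->
   ((polygonal_length gamma a s1)%:E + path_length c b gamma
     <= path_length a b gamma)%E.
  move=> p1; rewrite -leeBrDl//; apply: path_length_le => s2 p2.
  by rewrite leeBrDl//; exact: cat.
have [s0 p0] : exists s0, itv_partition a c s0.
  move: ac; rewrite le_eqVlt => /orP[/eqP <-|/itv_partition1]; last by exists [:: c].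
  by exists [::].
have cbf : path_length c b gamma \is a fin_num.
  rewrite ge0_fin_numE ?path_length_ge0// ltey; apply/eqP => cby.
  by have := cat _ p0; rewrite cby addey// leye_eq => /eqP; exact: abfin.
by rewrite -leeBrDr//; apply: path_length_le => s1 p1; rewrite leeBrDr// cat.
Qed.

End path_length.

(** * Arc length parametrization *)

Section arclength.
Context {R : realType} {V : completeNormedModType R}.
Variables (gamma : R -> V) (a b : R).
Hypotheses (ab : a <= b) (rect : (path_length a b gamma < +oo)%E).
Implicit Types s t u v : R.

Lemma path_length_fin_num s t : a <= s -> s <= t -> t <= b ->
  path_length s t gamma \is a fin_num.
Proof.
move=> as_ st tb; rewrite ge0_fin_numE ?path_length_ge0//.
apply: le_lt_trans rect.
rewrite (path_lengthD gamma as_ (le_trans st tb)) (path_lengthD gamma st tb).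
rewrite -[leLHS]add0e leeD ?path_length_ge0// -[leLHS]adde0 leeD//.
exact: path_length_ge0.
Qed.

Lemma arclengthE t : a <= t -> t <= b ->
  path_length a t gamma = (arclength a gamma t)%:E.
Proof. by move=> at_ tb; rewrite fineK// path_length_fin_num. Qed.

Lemma arclengthB s t : a <= s -> s <= t -> t <= b ->
  path_length s t gamma = (arclength a gamma t - arclength a gamma s)%:E.
Proof.
move=> as_ st tb.
rewrite EFinB -!arclengthE ?(le_trans as_ st) ?(le_trans st tb)//.
rewrite (path_lengthD gamma as_ st) addeAC subee ?add0e//.
by rewrite path_length_fin_num// (le_trans st tb).
Qed.

Lemma arclength_start : arclength a gamma a = 0.
Proof. by rewrite /arclength path_lengthxx. Qed.

Lemma dist_le_arclengthB s t : a <= s -> s <= t -> t <= b ->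
  `|gamma t - gamma s| <= arclength a gamma t - arclength a gamma s.
Proof.
by move=> as_ st tb; rewrite -lee_fin -arclengthB// dist_le_path_length.
Qed.

Lemma arclength_nondecreasing s t : a <= s -> s <= t -> t <= b ->
  arclength a gamma s <= arclength a gamma t.
Proof.
move=> as_ st tb; rewrite -subr_ge0.
exact: le_trans (normr_ge0 _) (dist_le_arclengthB as_ st tb).
Qed.

Lemma arclength_ge0 t : a <= t -> t <= b -> 0 <= arclength a gamma t.
Proof. by move=> at_ tb; rewrite -arclength_start arclength_nondecreasing. Qed.

Hypothesis cont : {within `[a, b], continuous gamma}.

Lemma path_continuous_dist t e : a <= t -> t <= b -> 0 < e ->
  exists2 d, 0 < d &
    forall s, a <= s -> s <= b -> `|t - s| < d -> `|gamma t - gamma s| < e.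
Proof.
move=> at_ tb e0.
have /subspace_continuousP/(_ t) := cont.
rewrite /= in_itv/= at_ tb => /(_ isT)/cvgrPdist_lt/(_ e e0).
rewrite near_withinE => /nbhs_ballP[d /= d0 H]; exists d => // s as_ sb ts.
by apply: H => //=; rewrite in_itv/= as_ sb.
Qed.

(** The arc length takes the value [u] at the supremum [t] of the times at which
    it is at most [u]. Length is lower semicontinuous: moving the last point of
    a partition of [[a, t]] slightly to the left gives [arclength t <= u], and
    moving the first point of a partition of [[t, b]] slightly to the right
    gives [path_length t b <= L - u], where [L] is the length on [[a, b]]. *)
Lemma arclength_surj u : 0 <= u -> u <= arclength a gamma b ->
  exists t, [/\ a <= t, t <= b & arclength a gamma t = u].
Proof.
move=> u0 uL.
pose E := [set t | [/\ a <= t, t <= b & arclength a gamma t <= u]].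
have Ea : E a by split => //; rewrite arclength_start.
have supE : has_sup E by split; [exists a|exists b => t []].
pose t := sup E.
have at_ : a <= t by apply: sup_upper_bound.
have tb : t <= b by apply: ge_sup; [exists a|move=> ? []].
exists t; split=> //; apply/le_anti/andP; split.
  (* [w] is a time before [t], of arc length at most [u], replacing [t] *)
  rewrite -lee_fin -arclengthE//; apply: path_length_le => s p.
  case/lastP: s p => [|s z] [+ +]; first by rewrite lee_fin.
  rewrite rcons_path last_rcons => /andP[sp sz] /eqP zt.
  rewrite {}zt in sz *.
  rewrite lee_fin; apply/ler_addgt0Pr => e e0.
  have [d d0 dP] := path_continuous_dist at_ tb e0.
  have m0 : 0 < Num.min d (t - last a s) by rewrite lt_min d0 subr_gt0.
  have [w [aw wb wu]] := sup_adherent m0 supE.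
  rewrite -/t ltrBlDr -ltrBlDl lt_min => /andP[wd ws].
  have wt : w <= t by apply: sup_upper_bound.
  have sw : last a s < w by lra.
  have := @polygonal_le_path_length _ _ gamma a w (rcons s w).
  rewrite arclengthE// lee_fin !polygonal_length_rcons => H.
  have {H} := H _; rewrite /itv_partition rcons_path last_rcons sp sw => /(_ _)H.
  have := ler_distD (gamma w) (gamma t) (gamma (last a s)).
  have : `|gamma t - gamma w| < e by apply: dP; rewrite // ger0_norm; lra.
  have := H (conj isT (eqxx _)).
  by lra.
(* [w] is now a time after [t], of arc length greater than [u] *)
have [tb'|bt] := ltP t b; last by rewrite (le_trans uL)// arclength_nondecreasing.
suff : (path_length t b gamma <= (arclength a gamma b - u)%:E)%E.
  by rewrite arclengthB// lee_fin lerD2l lerN2.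
apply: path_length_le => -[|z s] [/=].
  by move=> _ /eqP tb2; move: tb'; rewrite tb2 ltxx.
move=> /andP[tz zs] lz; rewrite lee_fin; apply/ler_addgt0Pr => e e0.
have zb : z <= b by apply: (@itv_partition_le _ _ z b s).
have [d d0 dP] := path_continuous_dist at_ tb e0.
pose m := Num.min d (z - t).
have m0 : 0 < m by rewrite lt_min d0 subr_gt0.
have [md mz] : m <= d /\ m <= z - t.
  by rewrite /m; split; rewrite ge_min lexx ?orbT.
pose w := t + m / 2.
have [tw wz] : t < w /\ w < z by rewrite /w; lra.
have uw : u < arclength a gamma w.
  rewrite ltNge; apply/negP => wu.
  have : w <= t by apply: sup_upper_bound => //; split=> //; lra.
  by rewrite leNgt tw.
have := @polygonal_le_path_length _ _ gamma w b (z :: s).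
have aw : a <= w by lra.
rewrite arclengthB ?(ltW (lt_le_trans wz zb))//= lee_fin => H.
have {}H : `|gamma z - gamma w| + polygonal_length gamma z s <=
  arclength a gamma b - arclength a gamma w by apply: H; split => //=; rewrite wz.
have := ler_distD (gamma w) (gamma z) (gamma t).
have : `|gamma t - gamma w| < e.
  by apply: dP; [lra|lra|rewrite distrC ger0_norm /w; lra].
rewrite (distrC (gamma t)).
by lra.
Qed.

Let L := arclength a gamma b.
Let sigma := arc_param a b gamma.

Lemma arc_paramP u : 0 <= u -> u <= L ->
  exists t, [/\ a <= t, t <= b, arclength a gamma t = u & sigma u = gamma t].
Proof.
move=> u0 uL; have [t [at_ tb tu]] := arclength_surj u0 uL.
rewrite /sigma /arc_param; case: xgetP => [s _ [+ su]|/(_ t)].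
  by rewrite in_itv/= => /andP[as_ sb]; exists s.
by rewrite /= in_itv/= at_ tb => -[].
Qed.

Lemma arc_param_in (P : V -> Prop) u : 0 <= u -> u <= L ->
  (forall t, t \in `[a, b] -> P (gamma t)) -> P (sigma u).
Proof.
move=> u0 uL gP; have [t [at_ tb _ ->]] := arc_paramP u0 uL.
by apply: gP; rewrite in_itv/= at_.
Qed.

Lemma arc_param_lipschitz u v : 0 <= u -> u <= L -> 0 <= v -> v <= L ->
  `|sigma u - sigma v| <= `|u - v|.
Proof.
move=> u0 uL v0 vL.
have [s [as_ sb <- ->]] := arc_paramP u0 uL.
have [t [at_ tb <- ->]] := arc_paramP v0 vL.
wlog st : s t as_ sb at_ tb / t <= s => [H|].
  have [|/ltW] := leP t s; first exact: H.
  by rewrite (distrC (gamma s)) (distrC (arclength a gamma s)); exact: H.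
by apply: le_trans (dist_le_arclengthB at_ st sb) _; exact: ler_norm.
Qed.

Lemma arc_param_start : sigma 0 = gamma a.
Proof.
have [t [at_ tb t0 ->]] := arc_paramP (lexx 0) (arclength_ge0 ab (lexx b)).
apply/eqP; rewrite -subr_eq0 -normr_le0.
apply: le_trans (dist_le_arclengthB _ at_ tb) _ => //.
by rewrite t0 arclength_start subrr.
Qed.

Lemma arc_param_end : sigma L = gamma b.
Proof.
have [t [at_ tb t0 ->]] := arc_paramP (arclength_ge0 ab (lexx b)) (lexx L).
apply/eqP; rewrite -subr_eq0 -normr_le0 distrC.
by apply: le_trans (dist_le_arclengthB at_ tb _) _ => //; rewrite t0 subrr.
Qed.

End arclength.

Section unit_speed.
Context {R : realType} {V : completeNormedModType R}.
Variables (gamma : R -> V) (L : R).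
Hypothesis speed : forall t, 0 <= t -> t <= L -> arclength 0 gamma t = t.

(** A path whose parameter is its arc length is its own arc length
    parametrization. *)
Lemma arc_param_unit_speed u : 0 <= u -> u <= L ->
  arc_param 0 L gamma u = gamma u.
Proof.
move=> u0 uL; rewrite /arc_param; congr gamma.
case: xgetP => [t _ [+ tu]|/(_ u)].
  by rewrite in_itv/= => /andP[t0 tL]; rewrite -tu speed.
by rewrite /= in_itv/= u0 uL speed// => -[].
Qed.

End unit_speed.

Section lipschitz_path.
Context {R : realType} {V : completeNormedModType R}.
Variables (gamma : R -> V) (L : R).
Hypothesis lip : forall s t, 0 <= s -> s <= t -> t <= L ->
  `|gamma t - gamma s| <= t - s.

Lemma lipschitz_path_length t : 0 <= t -> t <= L ->
  (path_length 0 t gamma <= t%:E)%E.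
Proof.
move=> t0 tL; apply: path_length_le => s p; rewrite lee_fin.
suff H c : itv_partition c t s -> 0 <= c -> polygonal_length gamma c s <= t - c.
  by rewrite -[leRHS]subr0 H.
elim: s c {p} => [|x s IHs] c /=.
  by move=> /itv_partition_nil ->; rewrite subrr.
move=> /[dup] p /itv_partition_cons xs c0.
have cx : c < x by case: p => /= /andP[].
have xt := itv_partition_le xs.
have : `|gamma x - gamma c| <= x - c by apply: lip; lra.
have := IHs x xs; lra.
Qed.

Lemma lipschitz_path_continuous : {within `[0, L], continuous gamma}.
Proof.
apply/subspace_continuousP => t; rewrite /= in_itv/= => /andP[t0 tL].
apply/cvgrPdist_lt => e e0; rewrite near_withinE; apply/nbhs_ballP.
exists e => //= s /=; rewrite /ball/= in_itv/= => ts /andP[s0 sL].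
apply: le_lt_trans ts; have [st|/ltW ts] := leP s t.
  by rewrite (ger0_norm (_ : 0 <= t - s)) ?subr_ge0 ?lip.
by rewrite (distrC (gamma t)) (distrC t) (ger0_norm (_ : 0 <= s - t)) ?subr_ge0 ?lip.
Qed.

End lipschitz_path.
(** * The functional defining the half space *)

Section functional.
Context {R : realType}.
Variable f : nat -> R.
Hypothesis f_l1 : l1 f.
Implicit Types (x y z u : c0 R) (g : nat -> R) (n N : nat).

(** The functional F : x |-> sum_n f_n x_n. *)
Definition functional x : R := limn (series (fun n => f n * x n)).

(** The l1-norm of [f], which is the norm of [functional]. *)
Definition l1_norm : R := limn [normed series f].

Lemma half_spaceE x : half_space f x = (0 < functional x) :> Prop.
Proof. by []. Qed.

Lemma norm_coord_le x n : `|x n| <= `|x|.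
Proof. exact: c0_norm_ub. Qed.

Lemma functional_is_cvg_norm x : cvgn [normed series (fun n => f n * x n)].
Proof.
apply: (@series_le_cvg _ _ (`|x| *: (fun n => `|f n|))).
- by move=> n; exact: normr_ge0.
- by move=> n; rewrite /= mulr_ge0.
- by move=> n; rewrite /= normrM mulrC ler_wpM2r// norm_coord_le.
- exact: is_cvg_seriesZ.
Qed.

Lemma functional_is_cvg x : cvgn (series (fun n => f n * x n)).
Proof. exact/normed_cvg/functional_is_cvg_norm. Qed.

Lemma functionalD x y : functional (x + y) = functional x + functional y.
Proof.
rewrite /functional -lim_seriesD; [|exact: functional_is_cvg..].
by congr (limn (series _)); apply/funext => n /=; rewrite -mulrDr.
Qed.

Lemma functionalZ k x : functional (k *: x) = k * functional x.
Proof.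
rewrite /functional -[RHS]lim_seriesZ; last exact: functional_is_cvg.
congr (limn (series _)); apply/funext => n /=.
by rewrite [LHS](_ : _ = f n * (k * x n))// mulrCA.
Qed.

Lemma functionalB x y : functional (x - y) = functional x - functional y.
Proof. by rewrite -scaleN1r functionalD functionalZ mulN1r. Qed.

Lemma functional_le x : `|functional x| <= l1_norm * `|x|.
Proof.
have := lim_series_norm (@functional_is_cvg_norm x).
rewrite -/(functional x) => /le_trans; apply.
rewrite mulrC -[leRHS](lim_seriesZ _ f_l1).
apply: ler_lim; [exact: functional_is_cvg_norm|exact: is_cvg_seriesZ|].
near=> n; apply: ler_sum => k _.
by rewrite /= normrM mulrC ler_wpM2r// norm_coord_le.
Unshelve. all: by end_near. Qed.

Lemma truncation_c0 N g : (fun n => if (n < N)%N then g n else 0) \in @c0_pred R.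
Proof.
rewrite inE/=; apply: cvg_near_cst; exists N => // n /= Nn.
by rewrite ltnNge Nn.
Qed.

(** The element of c0 equal to [g] below [N], and to 0 from [N] on. *)
Definition truncation N g : c0 R := C0 (truncation_c0 N g).

Lemma functional_truncation N g :
  functional (truncation N g) = \sum_(0 <= n < N) f n * g n.
Proof.
apply: cvg_lim => //; apply: cvg_near_cst; exists N => // n /= Nn.
rewrite /series/= (big_cat_nat (n := N))//= [X in _ + X]big_nat_cond.
rewrite [X in _ + X]big1 ?addr0 => [|k /andP[/andP[Nk _] _]]; last first.
  by rewrite ltnNge Nk mulr0.
by apply: eq_big_nat => k /andP[_ ->].
Qed.

(** The bound [functional_le] is optimal: the truncated sequences of signs of [f]
    almost attain it. *)
Lemma functional_norming c : c < l1_norm ->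
  exists2 u : c0 R, `|u| <= 1 & c < functional u.
Proof.
move=> cf; have /cvgrPdist_lt/(_ (l1_norm - c)) := f_l1.
rewrite subr_gt0 => /(_ cf)[N _ /(_ N (leqnn N))/= NP].
exists (truncation N (fun n => Num.sg (f n))).
  apply: c0_norm_le => n /=; case: ifP => _; rewrite ?normr0// normr_sg.
  by case: (f n != 0).
rewrite functional_truncation; under eq_bigr do rewrite mulrC -normrEsg.
move: NP; rewrite -/l1_norm => /(le_lt_trans (ler_norm _)).
by rewrite ltrD2l ltrN2.
Qed.

(** The [n]-th vector of the canonical basis of c0. *)
Definition basis_vector n : c0 R := truncation n.+1 (fun k => (k == n)%:R).

Lemma basis_vectorE n k : basis_vector n k = (k == n)%:R.
Proof.
rewrite /=; case: ifPn => //; rewrite -leqNgt => nk.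
by rewrite gtn_eqF.
Qed.

Lemma functional_basis_vector n : functional (basis_vector n) = f n.
Proof.
rewrite functional_truncation big_nat_recr//= eqxx mulr1 big_nat big1 ?add0r//.
by move=> k /andP[_ kn]; rewrite ltn_eqF// mulr0.
Qed.

Hypothesis f_neq0 : exists n, f n != 0.

Lemma l1_norm_gt0 : 0 < l1_norm.
Proof.
have [n fn] := f_neq0.
have := functional_le (basis_vector n); rewrite functional_basis_vector => H.
rewrite ltNge; apply/negP => f0.
have : `|f n| <= 0 by apply: le_trans H _; rewrite mulr_le0_ge0.
by rewrite normr_le0 (negPf fn).
Qed.

Lemma functional_dist_lt a b : functional a - l1_norm * `|a - b| <= functional b.
Proof.
rewrite lerBlDl -lerBlDr -functionalB; apply: le_trans (functional_le _).
exact: ler_norm.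
Qed.

Lemma boundary_half_space_le0 a : boundary (half_space f) a -> functional a <= 0.
Proof.
move=> [_]; apply: contra_notP => /negP; rewrite -ltNge => a0.
apply/nbhs_ballP; exists (functional a / l1_norm) => /=.
  by rewrite divr_gt0// l1_norm_gt0.
move=> b; rewrite -ball_normE/= ltr_pdivlMr ?l1_norm_gt0// => ab.
by apply: lt_le_trans (functional_dist_lt a b); rewrite subr_gt0 mulrC.
Qed.

Lemma boundary_half_space_eq0 a : functional a = 0 -> boundary (half_space f) a.
Proof.
move=> a0; split; last by move=> /interior_subset; rewrite half_spaceE a0 ltxx.
have [u u1 u0] := functional_norming l1_norm_gt0.
move=> B /nbhs_ballP[e /= e0 eB]; exists (a + (e / 2) *: u); split.
  rewrite half_spaceE functionalD functionalZ a0 add0r.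
  by rewrite mulr_gt0// divr_gt0.
apply: eB; rewrite -ball_normE/= opprD addNKr normrN normrZ gtr0_norm ?divr_gt0//.
by apply: (@le_lt_trans _ _ (e / 2)); [rewrite ler_piMr// ltW// divr_gt0|lra].
Qed.

(** The upper bound comes from following almost norming directions [u] down to
    the hyperplane. *)
Lemma edist_boundary_half_space z : half_space f z ->
  edist_inf (boundary (half_space f)) z = (functional z / l1_norm)%:E.
Proof.
rewrite half_spaceE => z0.
have f0 := l1_norm_gt0.
have q0 : 0 < functional z / l1_norm by rewrite divr_gt0.
apply/le_anti/andP; split; last first.
  apply: le_ereal_inf_tmp => _ [a /boundary_half_space_le0 a0 <-].
  apply: le_ereal_inf_tmp => _ [r [r0 /= +] <-]; rewrite -ball_normE/= => zr.
  rewrite lee_fin ler_pdivrMr// mulrC.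
  apply: (@le_trans _ _ (l1_norm * `|z - a|)); last by rewrite ler_pM2l// ltW.
  apply: le_trans (le_trans (ler_norm _) (functional_le _)).
  by rewrite functionalB; lra.
apply/lee_addgt0Pr => e e0; rewrite -EFinD.
pose r := functional z / l1_norm + e.
have r0 : 0 < r by rewrite addr_gt0.
have [|u u1 zu] := @functional_norming (functional z / r).
  by rewrite ltr_pdivrMr// mulrC -ltr_pdivrMr// /r ltrDl.
have u0 : 0 < functional u by apply: lt_trans zu; rewrite divr_gt0.
pose a := z - (functional z / functional u) *: u.
apply: (@le_trans _ _ (edist (z, a))).
  apply: ereal_inf_lbound; exists a => //; apply: boundary_half_space_eq0.
  by rewrite functionalB functionalZ divfK ?gt_eqF// subrr.
apply: edist_fin => //=; rewrite -ball_normE/= opprB addrC subrK normrZ.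
rewrite gtr0_norm ?divr_gt0//.
apply: (@le_lt_trans _ _ (functional z / functional u)).
  by rewrite ler_piMr// ltW// divr_gt0.
by rewrite ltr_pdivrMr// mulrC -ltr_pdivrMr.
Qed.

End functional.
(** * Strict comparison of integrals of continuous functions *)

Section integral_lt.
Context {R : realType}.
Local Notation mu := lebesgue_measure.
Implicit Types (g h : R -> R) (a b c t : R).

Lemma continuous_itv_integrable g a b : {within `[a, b], continuous g} ->
  mu.-integrable `[a, b] (EFin \o g).
Proof. by apply: continuous_compact_integrable; exact: segment_compact. Qed.

Lemma integral_itv_gt0 g a b t : {within `[a, b], continuous g} ->
  (forall s, a <= s -> s <= b -> 0 <= g s) -> a < t -> t < b -> 0 < g t ->
  (0 < \int[mu]_(s in `[a, b]) (g s)%:E)%E.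
Proof.
move=> gc g0 at_ tb gt0.
have /subspace_continuousP/(_ t) := gc.
rewrite /= in_itv/= (ltW at_) (ltW tb) => /(_ isT)/cvgrPdist_lt/(_ (g t / 2)).
rewrite divr_gt0// => /(_ isT); rewrite near_withinE => /nbhs_ballP[d /= d0 dP].
pose m := Num.min d (Num.min (t - a) (b - t)).
have m0 : 0 < m by rewrite !lt_min d0 !subr_gt0 at_.
have [md ma mb] : [/\ m <= d, m <= t - a & m <= b - t].
  by rewrite /m; split; rewrite !ge_min lexx ?orbT.
pose I := [set` `[t - m / 2, t + m / 2]].

have sub : I `<=` `[a, b].
  by move=> s; rewrite /I /= !in_itv/= => /andP[H1 H2]; apply/andP; split; lra.
have mI : measurable (I : set (measurableTypeR R)) by exact: measurable_itv.
have mg := measurable_int _ (continuous_itv_integrable gc).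
apply: (@lt_le_trans _ _ (\int[mu]_(s in I) (g s)%:E)%E); last first.
  apply: (ge0_subset_integral _ mI (measurable_itv _) mg) => //.
  move=> s; rewrite /= in_itv/= => /andP[H1 H2].
  by rewrite lee_fin g0.
apply: (@lt_le_trans _ _ (\int[mu]_(s in I) (cst (g t / 2)%R%:E s))%E).
  rewrite integral_cst//= lebesgue_measure_itv/= lte_fin.
  rewrite ifT; last by lra.
  by rewrite -EFinB -EFinM lte_fin mulr_gt0 ?divr_gt0//; lra.
apply: ge0_le_integral => //.
- by move=> s _; rewrite lee_fin ltW// divr_gt0.
- exact: measurable_funS sub mg.
move=> s /[dup] /sub sab; rewrite /I /= in_itv/= lee_fin => /andP[s1 s2].
have : `|g t - g s| < g t / 2.
  apply: dP => //; rewrite -ball_normE/= ltr_norml.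
  by apply/andP; split; lra.
by rewrite ltr_norml => /andP[H1 H2]; lra.
Qed.

Lemma integral_itv_lt g h a b t : {within `[a, b], continuous g} ->
  {within `[a, b], continuous h} ->
  (forall s, a <= s -> s <= b -> g s <= h s) -> a < t -> t < b -> g t < h t ->
  (\int[mu]_(s in `[a, b]) (g s)%:E < \int[mu]_(s in `[a, b]) (h s)%:E)%E.
Proof.
move=> gc hc gh at_ tb gt.
have ig := continuous_itv_integrable gc.
have ih := continuous_itv_integrable hc.
have mD : measurable ([set` `[a, b]] : set (measurableTypeR R)).
  exact: measurable_itv.
rewrite -sube_gt0 -[ltRHS](integralB mD ih ig).
rewrite [ltRHS](_ : _ = \int[mu]_(s in `[a, b]) (h s - g s)%:E)%E//.
apply: (integral_itv_gt0 _ _ at_ tb); last by rewrite subr_gt0.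
  move=> s; apply: continuousB; [exact: hc|exact: gc].
by move=> s as_ sb; rewrite subr_ge0 gh.
Qed.

End integral_lt.

(** * Unit speed coordinates *)

Section roof.
Context {R : realType}.
Implicit Types p q L s t : R.

(** The highest 1-Lipschitz function on [[0, L]] with value [p] at 0 and [q] at
    [L]: it goes up at unit speed and then down at unit speed. It takes these
    values only if [`|q - p| <= L]. *)
Definition roof p q L t : R := Num.min (p + t) (q + L - t).

Lemma roof_lipschitz p q L s t : s <= t ->
  `|roof p q L t - roof p q L s| <= t - s.
Proof.
move=> st; rewrite /roof ler_norml.
by case: (leP (p + t)); case: (leP (p + s)) => ? ?; apply/andP; split; lra.
Qed.

Lemma roof_start p q L : `|q - p| <= L -> roof p q L 0 = p.
Proof.
by rewrite ler_norml /roof addr0 subr0 => /andP[? ?]; apply/min_idPl; lra.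
Qed.

Lemma roof_end p q L : `|q - p| <= L -> roof p q L L = q.
Proof.
by rewrite ler_norml /roof addrK => /andP[? ?]; apply/min_idPr; lra.
Qed.

Lemma roof_ge p q L t r : `|r - p| <= t -> `|r - q| <= L - t ->
  r <= roof p q L t.
Proof.
rewrite !ler_norml /roof le_min => /andP[? ?] /andP[? ?].
by apply/andP; split; lra.
Qed.

(** A 1-Lipschitz path on [[0, L]] that moves at least as fast as a [roof] is
    parametrized by arc length. *)
Lemma roof_path_length {V : completeNormedModType R} (gamma : R -> V) p q L :
  `|q - p| <= L ->
  (forall s t, 0 <= s -> s <= t -> t <= L ->
    `|roof p q L t - roof p q L s| <= `|gamma t - gamma s| <= t - s) ->
  forall t, 0 <= t -> t <= L -> path_length 0 t gamma = t%:E.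
Proof.
move=> pqL H t t0 tL; apply/le_anti/andP; split.
  apply: (@lipschitz_path_length _ _ _ L) => // s u s0 su uL.
  by case/andP: (H s u s0 su uL).
have {}H s u : 0 <= s -> s <= u -> u <= L ->
    ((`|roof p q L u - roof p q L s|)%:E <= path_length s u gamma)%E.
  move=> s0 su uL; apply: le_trans (dist_le_path_length gamma su).
  by rewrite lee_fin; case/andP: (H s u s0 su uL).
(* the time at which the roof is highest *)
pose T := (L + q - p) / 2.
move: (pqL); rewrite ler_norml => /andP[pq1 pq2].
have T0 : 0 <= T by rewrite /T; lra.
have TL : T <= L by rewrite /T; lra.
have up s : s <= T -> roof p q L s = p + s.
  by rewrite /T => sT; apply/min_idPl; lra.
have down s : T <= s -> roof p q L s = q + L - s.
  by rewrite /T => sT; apply/min_idPr; lra.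
have [tT|/ltW Tt] := leP t T.
  apply: le_trans (H 0 t (lexx _) t0 tL).
  by rewrite !up// lee_fin ler_normr; apply/orP; left; lra.
rewrite (path_lengthD gamma T0 Tt).
apply: (@le_trans _ _ (T%:E + (t - T)%:E)%E).
  by rewrite -EFinD lee_fin; lra.
apply: leeD; [apply: le_trans (H 0 T (lexx _) T0 TL)|
  apply: le_trans (H T t T0 Tt tL)].
  by rewrite !up// lee_fin ler_normr; apply/orP; left; lra.
by rewrite !down// lee_fin ler_normr; apply/orP; right; lra.
Qed.

End roof.

(** * Quasihyperbolic length in the half space *)

Section qh_half_space.
Context {R : realType}.
Variable f : nat -> R.
Hypotheses (f_l1 : l1 f) (f_neq0 : exists n, f n != 0).

Lemma continuous_qh_density (sigma : R -> c0 R) (L : R) :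
  {within `[0, L], continuous sigma} ->
  (forall t, t \in `[0, L] -> half_space f (sigma t)) ->
  {within `[0, L], continuous (fun t => l1_norm f / functional f (sigma t))}.
Proof.
move=> sc sP; apply/subspace_continuousP => t tL.
have Fc : functional f (sigma s) @[s --> within `[0, L] (nbhs t)] -->
    functional f (sigma t).
  apply/cvgrPdist_lt => e e0.
  have f0 := l1_norm_gt0 f_l1 f_neq0.
  have /subspace_continuousP/(_ t tL)/cvgrPdist_lt/(_ (e / l1_norm f)) := sc.
  rewrite divr_gt0// => /(_ isT); apply: filterS => s /=.
  rewrite ltr_pdivlMr// mulrC => H; apply: le_lt_trans H.
  by rewrite -functionalB// functional_le.
apply: cvgM; first exact: cvg_cst.
by apply: cvgV Fc; rewrite gt_eqF// -half_spaceE; exact: sP.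
Qed.

(** The quasihyperbolic length as an integral of a real function; the hypothesis
    says that the arc length parametrization stays in the half space. *)
Lemma qh_length_half_space (a b : R) (gamma : R -> c0 R) :
  (forall u, 0 <= u -> u <= arclength a gamma b ->
    half_space f (arc_param a b gamma u)) ->
  qh_length (half_space f) a b gamma =
  (\int[lebesgue_measure]_(u in `[0%R, arclength a gamma b])
    (l1_norm f / functional f (arc_param a b gamma u))%:E)%E.
Proof.
move=> H; apply: eq_integral => u; rewrite inE/= in_itv/= => /andP[u0 uL].
have Hu := H u u0 uL.
rewrite edist_boundary_half_space// inver gt_eqF ?invf_div//.
by rewrite divr_gt0// l1_norm_gt0.
Qed.

End qh_half_space.

Section c00.
Context {R : realType}.
Implicit Types f : nat -> R.

Lemma not_c00_large f N : ~ c00 f -> exists2 n, (N <= n)%N & f n != 0.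
Proof.
apply: contra_notP => H; apply: (sub_finite_set _ (finite_II N)) => n /= fn.
by rewrite ltnNge; apply/negP => Nn; apply: H; exists n.
Qed.

Lemma c0_small (x : c0 R) (e : R) : 0 < e ->
  exists N, forall n, (N <= n)%N -> `|x n| < e.
Proof.
move=> e0; have /cvgrPdist_lt/(_ e e0)[N _ NP] := @c0_cvg R x.
by exists N => n /NP /=; rewrite sub0r normrN.
Qed.

End c00.

(** * Raising one coordinate of a path *)

Section raised_path.
Context {R : realType}.
Variables (f : nat -> R) (sigma : R -> c0 R) (L : R) (n : nat).
Hypothesis f_l1 : l1 f.
Hypothesis fn0 : f n != 0.
Hypothesis sigma_lip : forall s t, 0 <= s -> s <= t -> t <= L ->
  `|sigma t - sigma s| <= t - s.
Hypothesis L0 : 0 <= L.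

Let e : R := Num.sg (f n).
Let p := e * sigma 0 n.
Let q := e * sigma L n.

Let ee : e * e = 1. Proof. by rewrite -expr2 sqr_sg fn0. Qed.

Let ne : `|e| = 1. Proof. by rewrite normr_sg fn0. Qed.

Let coordB (x y : c0 R) k : (x - y) k = x k - y k. Proof. by []. Qed.

Let pqL : `|q - p| <= L.
Proof.
rewrite -mulrBr normrM ne mul1r -coordB.
by apply: le_trans (norm_coord_le _ _) _; rewrite -[leRHS]subr0 sigma_lip.
Qed.

(** The path [sigma] with its [n]-th coordinate replaced by the [roof] between the
    same endpoints, upside down if [f n < 0]. *)
Definition raised_path t : c0 R :=
  sigma t + (e * roof p q L t - sigma t n) *: basis_vector n.

Lemma raised_pathE t k :
  raised_path t k = if k == n then e * roof p q L t else sigma t k.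
Proof.
have -> : raised_path t k =
  sigma t k + (e * roof p q L t - sigma t n) * basis_vector n k by [].
rewrite basis_vectorE.
case: eqVneq => [->|_]; first by rewrite mulr1 addrC subrK.
by rewrite mulr0 addr0.
Qed.

Lemma raised_path_speed s t : 0 <= s -> s <= t -> t <= L ->
  `|roof p q L t - roof p q L s| <= `|raised_path t - raised_path s| <= t - s.
Proof.
move=> s0 st tL.
have nE : `|roof p q L t - roof p q L s| = `|(raised_path t - raised_path s) n|.
  by rewrite coordB !raised_pathE eqxx -mulrBr normrM ne mul1r.
rewrite nE norm_coord_le /=; apply: c0_norm_le => k.
have [->|kn] := eqVneq k n; first by rewrite -nE roof_lipschitz.
rewrite coordB !raised_pathE (negPf kn) -coordB.
by apply: le_trans (norm_coord_le _ _) _; exact: sigma_lip.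
Qed.

Lemma raised_path_start : raised_path 0 = sigma 0.
Proof.
by rewrite /raised_path roof_start// mulrA ee mul1r subrr scale0r addr0.
Qed.

Lemma raised_path_end : raised_path L = sigma L.
Proof.
by rewrite /raised_path roof_end// mulrA ee mul1r subrr scale0r addr0.
Qed.

Lemma functional_raised_path t : functional f (raised_path t) =
  functional f (sigma t) + `|f n| * (roof p q L t - e * sigma t n).
Proof.
rewrite functionalD// functionalZ// functional_basis_vector; congr +%R.
rewrite [`|f n|]normrEsg -/e.
rewrite (_ : sigma t n = e * (e * sigma t n)); last by rewrite mulrA ee mul1r.
by rewrite -!mulrBr (mulrA e e) ee mul1r mulrAC.
Qed.

Lemma sigma_le_roof t : 0 <= t -> t <= L -> e * sigma t n <= roof p q L t.
Proof.
move=> t0 tL; apply: roof_ge; rewrite -mulrBr normrM ne mul1r -coordB.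
  by apply: le_trans (norm_coord_le _ _) _; rewrite -[leRHS]subr0 sigma_lip.
by apply: le_trans (norm_coord_le _ _) _; rewrite distrC sigma_lip.
Qed.

Lemma functional_raised_path_le t : 0 <= t -> t <= L ->
  functional f (sigma t) <= functional f (raised_path t).
Proof.
move=> t0 tL; rewrite functional_raised_path lerDl mulr_ge0//.
by rewrite subr_ge0 sigma_le_roof.
Qed.

(** With the three coordinates smaller than [L / 8], the roof is higher than
    [L / 2 - L / 8] at time [L / 2], where the old coordinate is below [L / 8]. *)
Lemma functional_raised_path_lt :
  `|sigma 0 n| < L / 8 -> `|sigma L n| < L / 8 ->
  `|sigma (L / 2) n| < L / 8 ->
  functional f (sigma (L / 2)) < functional f (raised_path (L / 2)).
Proof.
move=> s0 sL sm.
rewrite functional_raised_path ltrDl mulr_gt0 ?normr_gt0// subr_gt0.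
have small r : `|r| < L / 8 -> `|e * r| < L / 8 by rewrite normrM ne mul1r.
move: (small _ s0) (small _ sL) (small _ sm).
rewrite -/p -/q !ltr_norml => /andP[? ?] /andP[? ?] /andP[? ?].
by rewrite /roof lt_min; apply/andP; split; lra.
Qed.

Lemma raised_path_rectifiable :
  (forall t, 0 <= t -> t <= L -> half_space f (sigma t)) ->
  rectifiable_path (half_space f) (sigma 0) (sigma L) 0 L raised_path.
Proof.
move=> sP; split => //.
- apply: lipschitz_path_continuous => s t s0 st tL.
  by case/andP: (raised_path_speed s0 st tL).
- move=> t; rewrite in_itv/= => /andP[t0 tL]; rewrite half_spaceE.
  by apply: lt_le_trans (functional_raised_path_le t0 tL); exact: sP.
- exact: raised_path_start.
- exact: raised_path_end.
- by rewrite (roof_path_length pqL raised_path_speed)// ltry.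
Qed.

Lemma raised_path_arclength t : 0 <= t -> t <= L ->
  arclength 0 raised_path t = t.
Proof.
by move=> t0 tL; rewrite /arclength (roof_path_length pqL raised_path_speed).
Qed.

End raised_path.
(** * Nonexistence of geodesics *)

Unset Implicit Arguments.

Theorem theorem2p3 (R : realType) (f : nat -> R) (hf : (l1 `\` c00) f)
    (x y : c0 R) (hx : half_space f x) (hy : half_space f y) (hxy : x <> y) :
  ~ exists (a b : R) (gamma : R -> c0 R),
      qh_geodesic (half_space f) x y a b gamma.
Proof.
move: hf => [f_l1 fNc00] [a [b [gamma [[ab cont gin ga gb rect]]]]].
apply/eqP; rewrite gt_eqF//.
have f_neq0 : exists n, f n != 0.
  by have [n _ fn] := not_c00_large 0%N fNc00; exists n.
have f0 := l1_norm_gt0 f_l1 f_neq0.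
pose L := arclength a gamma b; pose sigma := arc_param a b gamma.
have sigma0 : sigma 0 = x by rewrite -ga; exact: arc_param_start.
have sigmaL : sigma L = y by rewrite -gb; exact: arc_param_end.
have L0 : 0 < L.
  apply: (@lt_le_trans _ _ `|gamma b - gamma a|).
    by rewrite normr_gt0 subr_eq0 ga gb; apply/eqP => /esym.
  rewrite -[L]subr0 -(arclength_start gamma a).
  exact: (dist_le_arclengthB rect).
have slip s t : 0 <= s -> s <= t -> t <= L -> `|sigma t - sigma s| <= t - s.
  move=> s0 st tL; have := @arc_param_lipschitz _ _ gamma a b ab rect cont t s.
  rewrite (ger0_norm (_ : 0 <= t - s)) ?subr_ge0//; apply=> //.
    exact: le_trans st.
  exact: le_trans tL.
have sin t : 0 <= t -> t <= L -> half_space f (sigma t).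
  by move=> t0 tL; apply: (arc_param_in ab rect cont t0 tL).
have L8 : 0 < L / 8 by rewrite divr_gt0.
have [N1 N1P] := c0_small (sigma 0) L8.
have [N2 N2P] := c0_small (sigma L) L8.
have [N3 N3P] := c0_small (sigma (L / 2)) L8.
(* the coordinate to be raised: the end points and the middle point of [sigma]
   are small there, and [f] is not zero there *)
have [n + fn0] := not_c00_large (maxn N1 (maxn N2 N3)) fNc00.
rewrite !geq_max => /and3P[nN1 nN2 nN3].
pose tau := raised_path f sigma L n.
have tau_speed t : 0 <= t -> t <= L -> arclength 0 tau t = t.
  by apply: raised_path_arclength => //; exact: ltW.
have tauL : arclength 0 tau L = L by rewrite tau_speed// ltW.
have taup t : 0 <= t -> t <= L -> arc_param 0 L tau t = tau t.
  by move=> t0 tL; exact: arc_param_unit_speed.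
have taurect : rectifiable_path (half_space f) x y 0 L tau.
  by rewrite -sigma0 -sigmaL; apply: raised_path_rectifiable => //; exact: ltW.
apply: (@le_lt_trans _ _ (qh_length (half_space f) 0 L tau)).
  by apply: ereal_inf_lbound; exists 0, L, tau.
have tin t : 0 <= t -> t <= L -> half_space f (tau t).
  by move=> t0 tL; apply: (path_in taurect); rewrite in_itv/= t0.
rewrite !qh_length_half_space//; last first.
  by move=> u; rewrite tauL => u0 uL; rewrite taup//; exact: tin.
rewrite tauL -/L -/sigma.
under eq_integral.
  move=> u; rewrite inE/= in_itv/= => /andP[u0 uL].
  rewrite taup//; over.
apply: (@integral_itv_lt _ _ _ _ _ (L / 2)).
- apply: continuous_qh_density => //; first exact: (path_continuous taurect).
  by move=> t; rewrite in_itv/= => /andP[t0 tL]; exact: tin.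
- apply: continuous_qh_density => //; first exact: lipschitz_path_continuous.
  by move=> t; rewrite in_itv/= => /andP[t0 tL]; exact: sin.
- move=> s s0 sL; rewrite ler_pM2l// lef_pV2 ?posrE.
  + exact: functional_raised_path_le.
  + exact: (tin s).
  + exact: (sin s).
- by rewrite divr_gt0.
- by lra.
have [l0 lL] : 0 <= L / 2 /\ L / 2 <= L by lra.
rewrite ltr_pM2l// ltf_pV2 ?posrE; [|exact: (tin _ l0 lL)|exact: (sin _ l0 lL)].
apply: functional_raised_path_lt => //.
- exact: N1P.
- exact: N2P.
- exact: N3P.
Qed.
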